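(* Let $R$ be the ring and $d_0\colon R^2\to R^2$ the map defined in the context. Set $M=\operatorname{Coker} d_0^*$, where $d_0^*=\operatorname{Hom}_R(d_0,R)$, and $N=R/(t,u,v-x,y-x,z-x)$. Then $$\operatorname{Ext}^i_R(M,N)=0\ \text{ for all } i>0\qquad\text{and}\qquad \operatorname{Ext}^i_R(N,M)\neq 0\ \text{ for all } i>0.$$
   Context: Let $k$ be a field which is not algebraic over a finite field, and let $\alpha\in k$ be an element of infinite multiplicative order. Let $P=k[T,U,V,X,Y,Z]$ be the polynomial ring in six variables (each of degree one) and $R=P/I$, where $I$ is generated by the fifteen quadrics $$Z^2,\ UZ-TX-\alpha UV,\ U^2,\ YZ+VY,\ UY,\ Y^2-TX-(\alpha-1)UV,\ XZ+\alpha VX,\ UX,\ XY,\ X^2-TX-TV,$$ $$TZ+TY+\alpha VX,\ TU,\ TY-VX+TV,\ T^2+(\alpha+1)UV-VY,\ V^2.$$ Let $t,u,v,x,y,z$ denote the residue classes of the variables modulo $I$. The map $d_0\colon R^2\to R^2$ is given, acting on column vectors in the standard basis, by the matrix $\begin{pmatrix} v& y\\ \alpha x& z\end{pmatrix}$. *)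

(* Defs.v *)
From HB Require Import structures.
From mathcomp Require Import all_boot all_order all_algebra.
From mathcomp Require Import ring_quotient.
From mathcomp Require Import boolp.
From mathcomp Require Import finmap monalg.

Set Implicit Arguments.
Unset Strict Implicit.
Unset Printing Implicit Defensive.

Import GRing.Theory.
Local Open Scope ring_scope.
Local Open Scope quotient_scope.

Section Submodules.
Variables (R : comNzRingType) (U V : lmodType R).

Definition lspan (s : seq V) : {pred V} :=
  fun v => `[< exists c : 'I_(size s) -> R, v = \sum_(i < size s) c i *: s`_i >].

Lemma lspan_closed s : submod_closed (lspan s).
Proof.
split; first by apply/asboolP; exists (fun=> 0); rewrite big1 // => i _; rewrite scale0r.
move=> a u v /asboolP[c ->] /asboolP[d ->]; apply/asboolP.
exists (fun i => a * c i + d i); rewrite scaler_sumr -big_split /=.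
by apply: eq_bigr => i _; rewrite scalerDl scalerA.
Qed.

HB.instance Definition _ s := GRing.isSubmodClosed.Build R V (lspan s) (lspan_closed s).

Definition lker (f : {linear U -> V}) : {pred U} := fun u => f u == 0.

Lemma lker_closed f : submod_closed (lker f).
Proof.
split; first by rewrite unfold_in linear0.
by move=> a u v; rewrite !unfold_in linearP => /eqP-> /eqP->; rewrite scaler0 addr0.
Qed.

HB.instance Definition _ f := GRing.isSubmodClosed.Build R U (lker f) (lker_closed f).

Definition limg (f : {linear U -> V}) : {pred V} := fun v => `[< exists u, v = f u >].

Lemma limg_closed f : submod_closed (limg f).
Proof.
split; first by apply/asboolP; exists 0; rewrite linear0.
move=> a u v /asboolP[x ->] /asboolP[y ->]; apply/asboolP.
by exists (a *: x + y); rewrite linearP.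
Qed.

HB.instance Definition _ f := GRing.isSubmodClosed.Build R V (limg f) (limg_closed f).

Definition lpreim (f : {linear U -> V}) (S : submodClosed V) : {pred U} :=
  fun u => f u \in S.

Lemma lpreim_closed f S : submod_closed (lpreim f S).
Proof.
have E u : (u \in lpreim f S) = (f u \in S) by [].
split=> [|a u v]; rewrite !E ?linear0 ?rpred0 // linearP => fu fv.
by rewrite rpredD ?rpredZ.
Qed.

HB.instance Definition _ f S := GRing.isSubmodClosed.Build R U (lpreim f S) (lpreim_closed f S).

End Submodules.

Section Submod.
Variables (R : comNzRingType) (V : lmodType R) (S : submodClosed V).

Record submod := Submod { submod_val :> V; _ : submod_val \in S }.

HB.instance Definition _ := [isSub for submod_val].
HB.instance Definition _ := [Choice of submod by <:].
HB.instance Definition _ := [SubChoice_isSubLmodule of submod by <:].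

End Submod.

Section QuotientModule.
Variables (R : comNzRingType) (V : lmodType R) (S : submodClosed V).

(* A submodClosed predicate is only known to the library to be closed under sums
   and scaling; over a ring it is also closed under opposites. *)
Lemma submod_oppr_closed : oppr_closed S.
Proof. by move=> v Sv; rewrite -scaleN1r rpredZ. Qed.

Definition submod_zmod : zmodClosed V :=
  HB.pack (GRing.SubmodClosed.sort S)
    (GRing.isOppClosed.Build V (GRing.SubmodClosed.sort S) submod_oppr_closed).

Definition lquot : Type := Quotient.quot submod_zmod.

HB.instance Definition _ := GRing.Zmodule.on lquot.

Definition lquot_pi (v : V) : lquot := \pi_(Quotient.quot submod_zmod) v.
Definition lquot_scale (a : R) (x : lquot) : lquot := lquot_pi (a *: repr x).

Lemma lquot_piP u v : lquot_pi u = lquot_pi v <-> u - v \in S.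
Proof.
rewrite /lquot_pi; split; first by move=> /eqP; rewrite -Quotient.idealrBE.
by move=> uv; apply/eqP; rewrite -Quotient.idealrBE.
Qed.

Lemma lquot_piB u v : lquot_pi (u - v) = lquot_pi u - lquot_pi v.
Proof. exact: (raddfB \pi_(Quotient.quot submod_zmod)). Qed.

Lemma lquot_piD u v : lquot_pi (u + v) = lquot_pi u + lquot_pi v.
Proof. exact: (raddfD \pi_(Quotient.quot submod_zmod)). Qed.

Lemma lquot_reprK x : lquot_pi (repr (x : Quotient.quot submod_zmod)) = x.
Proof. exact: reprK. Qed.

Lemma lquot_piZ a v : lquot_pi (a *: v) = lquot_scale a (lquot_pi v).
Proof.
apply/lquot_piP; rewrite -scalerBr; apply: rpredZ.
by apply/lquot_piP; rewrite lquot_reprK.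
Qed.

Lemma lquot_scaleA a b x : lquot_scale a (lquot_scale b x) = lquot_scale (a * b) x.
Proof. by rewrite -(lquot_reprK x) -!lquot_piZ scalerA. Qed.

Lemma lquot_scale1 : left_id 1 lquot_scale.
Proof. by move=> x; rewrite -(lquot_reprK x) -lquot_piZ scale1r. Qed.

Lemma lquot_scaleDr : right_distributive lquot_scale +%R.
Proof.
move=> a x y; rewrite -(lquot_reprK x) -(lquot_reprK y).
by rewrite -lquot_piD -!lquot_piZ -lquot_piD scalerDr.
Qed.

Lemma lquot_scaleDl x : {morph lquot_scale^~ x : a b / a + b}.
Proof.
by move=> a b; rewrite -(lquot_reprK x) -!lquot_piZ -lquot_piD scalerDl.
Qed.

HB.instance Definition _ := GRing.Zmodule_isLmodule.Build R lquot
  lquot_scaleA lquot_scale1 lquot_scaleDr lquot_scaleDl.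

Lemma lquot_pi_zmod_morphism : zmod_morphism lquot_pi.
Proof. exact: lquot_piB. Qed.

Lemma lquot_pi_scalable : scalable lquot_pi.
Proof. exact: lquot_piZ. Qed.

HB.instance Definition _ := GRing.isZmodMorphism.Build V lquot lquot_pi
  lquot_pi_zmod_morphism.
HB.instance Definition _ := GRing.isScalable.Build R V lquot *:%R lquot_pi
  lquot_pi_scalable.

End QuotientModule.

Definition coker (R : comNzRingType) (U V : lmodType R) (f : {linear U -> V}) :
  lmodType R := lquot (limg f).

Section Hom.
Variables (R : comNzRingType) (U V : lmodType R).

Definition hom : Type := {linear U -> V}.

HB.instance Definition _ := gen_eqMixin hom.
HB.instance Definition _ := gen_choiceMixin hom.

Definition hom_fun (f : hom) : {linear U -> V} := f.
Coercion hom_fun : hom >-> GRing.Linear.type.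

Lemma hom_ext (f g : hom) : f =1 g -> f = g.
Proof.
case: f g => [f [[fA] [fZ]]] [g [[gA] [gZ]]] /= /funext fg.
by case: g / fg gA gZ => gA gZ; rewrite (Prop_irrelevance fA gA) (Prop_irrelevance fZ gZ).
Qed.

Definition hom_zero : hom := (\0 : U -> V) : {linear U -> V}.
Definition hom_opp (f : hom) : hom := (\- f : U -> V) : {linear U -> V}.
Definition hom_add (f g : hom) : hom := (f \+ g : U -> V) : {linear U -> V}.
Definition hom_scale (a : R) (f : hom) : hom := (a \*: f : U -> V) : {linear U -> V}.

Lemma hom_addA : associative hom_add.
Proof. by move=> f g h; apply: hom_ext => u /=; rewrite addrA. Qed.

Lemma hom_addC : commutative hom_add.
Proof. by move=> f g; apply: hom_ext => u /=; rewrite addrC. Qed.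

Lemma hom_add0 : left_id hom_zero hom_add.
Proof. by move=> f; apply: hom_ext => u /=; rewrite add0r. Qed.

Lemma hom_addN : left_inverse hom_zero hom_opp hom_add.
Proof. by move=> f; apply: hom_ext => u /=; rewrite addNr. Qed.

HB.instance Definition _ := GRing.isZmodule.Build hom
  hom_addA hom_addC hom_add0 hom_addN.

Lemma hom_scaleA a b f : hom_scale a (hom_scale b f) = hom_scale (a * b) f.
Proof. by apply: hom_ext => u /=; rewrite scalerA. Qed.

Lemma hom_scale1 : left_id 1 hom_scale.
Proof. by move=> f; apply: hom_ext => u /=; rewrite scale1r. Qed.

Lemma hom_scaleDr : right_distributive hom_scale +%R.
Proof. by move=> a f g; apply: hom_ext => u /=; rewrite scalerDr. Qed.

Lemma hom_scaleDl f : {morph hom_scale^~ f : a b / a + b}.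
Proof. by move=> a b; apply: hom_ext => u /=; rewrite scalerDl. Qed.

HB.instance Definition _ := GRing.Zmodule_isLmodule.Build R hom
  hom_scaleA hom_scale1 hom_scaleDr hom_scaleDl.

End Hom.

Section HomPrecomposition.
Variables (R : comNzRingType) (U V N : lmodType R) (d : {linear U -> V}).

(* For d : U -> V, the map d^* = Hom_R(d, N) : Hom_R(V, N) -> Hom_R(U, N). *)
Definition hom_pre (f : hom V N) : hom U N := (f \o d : U -> N) : {linear U -> N}.

Lemma hom_pre_zmod_morphism : zmod_morphism hom_pre.
Proof. by move=> f g; apply: hom_ext. Qed.

Lemma hom_pre_scalable : scalable hom_pre.
Proof. by move=> a f; apply: hom_ext. Qed.

HB.instance Definition _ := GRing.isZmodMorphism.Build (hom V N) (hom U N) hom_pre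
  hom_pre_zmod_morphism.
HB.instance Definition _ := GRing.isScalable.Build R (hom V N) (hom U N) *:%R hom_pre
  hom_pre_scalable.

End HomPrecomposition.
Arguments hom_pre {R U V} N d f.

Definition exact (R : comNzRingType) (A B C : lmodType R)
    (f : {linear A -> B}) (g : {linear B -> C}) : Prop :=
  forall b, g b = 0 <-> exists a, b = f a.

Definition surjective (A B : Type) (f : A -> B) : Prop := forall b, exists a, f a = b.

Definition projective (R : comNzRingType) (P : lmodType R) : Prop :=
  forall (A B : lmodType R) (g : {linear A -> B}) (f : {linear P -> B}),
    surjective g -> exists h : {linear P -> A}, forall x, g (h x) = f x.

Record projective_resolution (R : comNzRingType) (M : lmodType R) := ProjectiveResolution {
  res_obj :> nat -> lmodType R;
  res_d : forall n, {linear res_obj n.+1 -> res_obj n};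
  res_aug : {linear res_obj 0%N -> M};
  res_projective : forall n, projective (res_obj n);
  res_exact : forall n, exact (res_d n.+1) (res_d n);
  res_exact0 : exact (res_d 0%N) res_aug;
  res_surjective : surjective res_aug }.

Section FreeModule.
Variables (R : comNzRingType) (K : choiceType).

Definition free_module : lmodType R := {malg R[K]}.

Definition free_basis (k : K) : free_module := << 1 *g k >>.

Section Lift.
Variables (A : lmodType R) (a : K -> A).

Definition free_lift (g : free_module) : A := \sum_(k <- msupp g) g@_k *: a k.

Lemma free_liftEw (d : {fset K}) (g : free_module) :
  (msupp g `<=` d)%fset -> free_lift g = \sum_(k <- d) g@_k *: a k.
Proof.
move=> gd; rewrite /free_lift (big_fset_incl _ gd) // => k _ /mcoeff_outdom ->.
by rewrite scale0r.
Qed.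

Lemma free_lift_zmod_morphism : zmod_morphism free_lift.
Proof.
move=> g h; pose d := (msupp g `|` msupp h)%fset.
rewrite (free_liftEw (fsubsetUl _ _ : msupp g `<=` d)%fset).
rewrite (free_liftEw (fsubsetUr _ _ : msupp h `<=` d)%fset).
rewrite (free_liftEw (msuppB_le g h : _ `<=` d)%fset) -sumrB.
by apply: eq_bigr => k _; rewrite mcoeffB scalerBl.
Qed.

Lemma free_lift_scalable : scalable free_lift.
Proof.
move=> c g; rewrite (free_liftEw (msuppZ_le c g)) scaler_sumr.
by apply: eq_bigr => k _; rewrite mcoeffZ scalerA.
Qed.

HB.instance Definition _ := GRing.isZmodMorphism.Build free_module A free_lift
  free_lift_zmod_morphism.
HB.instance Definition _ := GRing.isScalable.Build R free_module A *:%R free_lift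
  free_lift_scalable.

Lemma free_lift_basis k : free_lift (free_basis k) = a k.
Proof.
rewrite (@free_liftEw [fset k]%fset) ?msuppU_le // big_seq_fset1.
by rewrite mcoeffUU scale1r.
Qed.

End Lift.

Lemma free_lift_unique (A : lmodType R) (f : {linear free_module -> A}) g :
  f g = free_lift (f \o free_basis) g.
Proof.
rewrite {1}[g]monalgE linear_sum; apply: eq_bigr => k _ /=.
rewrite -linearZ; congr (f _); apply/malgP => k'.
by rewrite mcoeffZ !mcoeffU mulrnAr mulr1.
Qed.

Lemma free_module_projective : projective free_module.
Proof.
move=> A B g f g_surj; have [a ga] := choice (fun k => g_surj (f (free_basis k))).
exists (free_lift a) => x; rewrite (free_lift_unique f) linear_sum.
by apply: eq_bigr => k _; rewrite linearZ ga.
Qed.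

End FreeModule.

(* The resolution of M by the free modules on the underlying sets of M and of its
   successive syzygies. *)
Section StandardResolution.
Variable R : comNzRingType.

Definition free_cover (M : lmodType R) : {linear free_module R M -> M} :=
  free_lift (id : M -> M).

Definition syzygy (M : lmodType R) : lmodType R := submod (lker (free_cover M)).

Lemma free_cover_surjective M : surjective (free_cover M).
Proof. by move=> m; exists (free_basis R m); apply: free_lift_basis. Qed.

Variable M : lmodType R.

Fixpoint syzygies (n : nat) : lmodType R :=
  if n is n'.+1 then syzygy (syzygies n') else M.

Definition standard_obj n : lmodType R := free_module R (syzygies n).

Definition standard_d n : {linear standard_obj n.+1 -> standard_obj n} :=
  (val \o free_cover (syzygies n.+1) : standard_obj n.+1 -> standard_obj n).

Lemma standard_d_img n b : free_cover (syzygies n) b = 0 <-> exists a, b = standard_d n a.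
Proof.
split=> [/eqP b0|[a ->]]; last exact/eqP/(valP (free_cover (syzygies n.+1) a)).
have b_ker : b \in lker (free_cover (syzygies n)) by [].
have [a ab] := free_cover_surjective (Submod b_ker : syzygies n.+1).
by exists a; rewrite /= ab.
Qed.

Lemma standard_exact n : exact (standard_d n.+1) (standard_d n).
Proof.
move=> b; rewrite -standard_d_img; split=> [b0|b0]; last by rewrite /= b0.
by apply: val_inj; apply: etrans b0 _; rewrite raddf0.
Qed.

Definition standard_resolution : projective_resolution M :=
  @ProjectiveResolution R M standard_obj standard_d (free_cover M)
    (fun n => @free_module_projective R (syzygies n)) standard_exact (@standard_d_img 0%N)
    (@free_cover_surjective M).

End StandardResolution.

Section Ext.
Variable R : comNzRingType.

(* ker g / im f; in a complex, where g \o f = 0, im f is contained in ker g. *)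
Definition homology (A B C : lmodType R) (f : {linear A -> B}) (g : {linear B -> C}) :
  lmodType R := lquot (lpreim (val : submod (lker g) -> B) (limg f)).

(* The cohomology in degree i of the complex Hom_R(P, N). *)
Definition Ext_of (M : lmodType R) (P : projective_resolution M) (N : lmodType R)
    (i : nat) : lmodType R :=
  match i with
  | 0 => homology (\0 : hom (P 0%N) N -> hom (P 0%N) N) (hom_pre N (res_d P 0%N))
  | j.+1 => homology (hom_pre N (res_d P j)) (hom_pre N (res_d P j.+1))
  end.

Definition Ext (i : nat) (M N : lmodType R) : lmodType R :=
  Ext_of (standard_resolution M) N i.

End Ext.

From mathcomp Require Import mpoly.

(* The condition a != 0 is needed, since 0 ^+ n != 1 holds for all n > 0. *)
Definition infinite_order (k : fieldType) (a : k) : Prop :=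
  a != 0 /\ forall n, (0 < n)%N -> a ^+ n != 1.

Definition algebraic_over_finite_field (k : fieldType) : Prop :=
  exists (F : finFieldType) (f : {rmorphism F -> k}), forall x : k, algebraicOver f x.

Section Ring.
Variables (k : fieldType) (alpha : k).

Notation P := {mpoly k[6]}.
Notation var j := ('X_(@Ordinal 6 j isT) : P).
(* The variables with indices 0, ..., 5 are T, U, V, X, Y, Z in this order. *)
Notation T := (var 0).
Notation U := (var 1).
Notation V := (var 2).
Notation X := (var 3).
Notation Y := (var 4).
Notation Z := (var 5).

Definition quadrics : seq P := [::
  Z ^+ 2;
  U * Z - T * X - alpha *: (U * V);
  U ^+ 2;
  Y * Z + V * Y;
  U * Y;
  Y ^+ 2 - T * X - (alpha - 1) *: (U * V);
  X * Z + alpha *: (V * X);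
  U * X;
  X * Y;
  X ^+ 2 - T * X - T * V;
  T * Z + T * Y + alpha *: (V * X);
  T * U;
  T * Y - V * X + T * V;
  T ^+ 2 + (alpha + 1) *: (U * V) - V * Y;
  V ^+ 2].

(* P^o is P as a module over itself, so that its submodules are the ideals of P. *)
Definition ideal_I : {pred P} := lspan (quadrics : seq P^o).

Lemma quadrics_at0 q : q \in quadrics -> q.@[fun=> 0] = 0.
Proof.
move=> q_in; apply/eqP; move: q q_in; apply/allP.
by rewrite /= !(mevalD, mevalN, mevalM, rmorphXn, mevalZ) /= !mevalXU
  !(mul0r, mulr0, expr0n, addr0, oppr0, eqxx).
Qed.

Lemma ideal_I_closed : idealr_closed ideal_I.
Proof.
have [I0 Ilin] := lspan_closed (quadrics : seq P^o).
split=> //; apply/asboolP => -[c /(congr1 (meval (fun=> 0)))] /eqP.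
rewrite rmorph1 rmorph_sum big1 ?oner_eq0 // => i _.
by rewrite [LHS]rmorphM /= [X in _ * X]quadrics_at0 ?mulr0 // mem_nth.
Qed.

HB.instance Definition _ := isIdealr.Build P ideal_I ideal_I_closed.

Definition ring_R : comNzRingType := {ideal_quot ideal_I}.

Definition cls (p : P) : ring_R := \pi_(Quotient.quot ideal_I) p.

Notation t := (cls T).
Notation u := (cls U).
Notation v := (cls V).
Notation x := (cls X).
Notation y := (cls Y).
Notation z := (cls Z).

Definition d0_mx : 'M[ring_R]_2 := \matrix_(i, j)
  nth 0 (nth [::] [:: [:: v; y]; [:: cls (alpha *: X); z]] i) j.

Definition d0 : {linear 'cV[ring_R]_2 -> 'cV[ring_R]_2} := mulmx d0_mx.

Definition module_M : lmodType ring_R := coker (hom_pre ring_R^o d0).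

Definition module_N : lmodType ring_R :=
  lquot (lspan ([:: t; u; v - x; y - x; z - x] : seq ring_R^o)).

End Ring.

(* Main.v *)
Require Import Defs.
From mathcomp Require Import all_boot all_algebra.
From HB Require Import structures.
From mathcomp Require Import ring_quotient boolp mpoly ring.

(* The ring R is the Gorenstein algebra of an explicit cubic form, so it has a basis of
   14 monomials and every question about R^2 becomes linear algebra over k.  With
   D_a = (v, y; a x, z) one finds D_a^T D_(a alpha)^T = 0, and the kernel of D_a^T is the
   image of D_(a alpha)^T as soon as a and a alpha differ from 0 and 1.  Hence M is resolved
   by R^2 with differentials D_(alpha^n)^T, n > 0.  On N = k[x]/(x^2) such a differential is
   x times an invertible matrix, so Hom(-, N) of the resolution is exact in positive degrees.

   For the second half, s = (t, t - x) represents a socle element of M which is not in uM,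
   because t y s_1 = t^2 y <> 0 while t y kills u and the first coordinates of the relations
   of M.  As u^2 = 0 and u N = 0, a resolution F of N contains basis elements e_j of F_j with
   d e_(j+1) = u e_j.  A cocycle F_j -> k s with value s at e_j cannot be a coboundary h d,
   for then s = u h(e_(j-1)). *)

Set Implicit Arguments.
Unset Strict Implicit.
Unset Printing Implicit Defensive.

Import GRing.Theory.
Local Open Scope ring_scope.
Local Open Scope quotient_scope.

(** * Ext and projective resolutions *)

Section Homological.
Variable R : comNzRingType.
Implicit Types (U V W K P Q M N : lmodType R).

Definition linear_of U V (f : U -> V) (f_lin : linear f) : {linear U -> V} :=
  HB.pack f (GRing.isLinear.Build R U V *:%R f f_lin).

Lemma Ext_of_eq0 M (P : projective_resolution M) N j :
  (forall c : {linear P j.+1 -> N}, (forall x, c (res_d P j.+1 x) = 0) ->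
     exists h : {linear P j -> N}, forall x, c x = h (res_d P j x)) ->
  forall e : Ext_of P N j.+1, e = 0.
Proof.
move=> coboundary e; rewrite -[e]lquot_reprK; set w := repr _.
rewrite -[RHS](linear0 (@lquot_pi _ _ _)); apply/lquot_piP; rewrite subr0.
have c_ker x : val w (res_d P j.+1 x) = 0.
  by have /eqP/(congr1 (fun f : Defs.hom _ _ => f x)) := valP w.
have [h hE] := coboundary (val w : Defs.hom _ _) c_ker.
by apply/asboolP; exists h; apply: hom_ext.
Qed.

Lemma Ext_of_neq0 M (P : projective_resolution M) N j (c : {linear P j.+1 -> N}) :
  (forall x, c (res_d P j.+1 x) = 0) ->
  ~ (exists h : {linear P j -> N}, forall x, c x = h (res_d P j x)) ->
  exists e : Ext_of P N j.+1, e <> 0.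
Proof.
move=> c_ker c_not_coboundary.
have c_in : (c : Defs.hom _ _) \in Defs.lker (hom_pre N (res_d P j.+1)).
  by apply/eqP/hom_ext => x; apply: c_ker.
exists (lquot_pi _ (Submod c_in)); rewrite -[X in _ <> X](linear0 (@lquot_pi _ _ _)).
move=> /lquot_piP; rewrite subr0 => /asboolP[h hE]; apply: c_not_coboundary.
by exists h => x; apply: (congr1 (fun f : Defs.hom _ _ => f x) hE).
Qed.

Definition short_exact K P W (i : {linear K -> P}) (g : {linear P -> W}) : Prop :=
  [/\ injective i, exact i g & surjective g].

Definition extends_along K P (i : {linear K -> P}) N : Prop :=
  forall f : {linear K -> N}, exists h : {linear P -> N}, forall x, f x = h (i x).

(** Since [i] is injective, the preimages chosen pointwise are unique, hence linear in the
    argument. *)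
Lemma lift_to_kernel U K P W (i : {linear K -> P}) (g : {linear P -> W})
    (f : {linear U -> P}) :
  short_exact i g -> (forall x, g (f x) = 0) ->
  exists f' : {linear U -> K}, forall x, i (f' x) = f x.
Proof.
move=> [i_inj ig_exact _] gf0.
have [f' f'E] := choice (fun x => (ig_exact (f x)).1 (gf0 x)).
have f'_lin : linear f' by move=> a x y; apply: i_inj; rewrite linearP -!f'E linearP.
by exists (linear_of f'_lin) => x; rewrite -f'E.
Qed.

Lemma short_exact_submod P W (S : submodClosed P) (g : {linear P -> W}) :
  (forall b, g b = 0 <-> b \in S) -> surjective g ->
  short_exact (val : {linear submod S -> P}) g.
Proof.
move=> ker_g g_surj; split=> [|b|//]; first exact: val_inj.
rewrite ker_g; split=> [b_in|[a ->]]; last exact: valP.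
by exists (Submod b_in).
Qed.

Lemma corestriction U V (f : {linear U -> V}) :
  exists f' : {linear U -> submod (Defs.limg f)}, surjective f' /\ forall w, val (f' w) = f w.
Proof.
have f_in w : f w \in Defs.limg f by apply/asboolP; exists w.
have f'_lin : linear (fun w => Submod (f_in w)) by move=> a w w'; apply/val_inj/linearP.
exists (linear_of f'_lin); split=> // -[b b_in].
by have /asboolP[w bE] := b_in; exists w; apply: val_inj.
Qed.

(* W is a direct summand of W' up to maps that factor through a projective module; this
   passes to syzygies, and so allows one to replace the standard resolution. *)
Definition stable_retract W W' : Prop :=
  exists (a : {linear W -> W'}) (b : {linear W' -> W})
    (Q : lmodType R) (p : {linear W -> Q}) (q : {linear Q -> W}),
  projective Q /\ forall w, w = b (a w) + q (p w).

Lemma stable_retract_refl W : stable_retract W W.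
Proof.
exists idfun, idfun, (free_module R unit : lmodType R), \0, \0.
by split=> [|w]; [apply: free_module_projective | rewrite addr0].
Qed.

Section Syzygy.
Variables (K P W K' P' W' : lmodType R).
Variables (i : {linear K -> P}) (g : {linear P -> W}).
Variables (i' : {linear K' -> P'}) (g' : {linear P' -> W'}).

(** The maps [a], [b], [q] of the retract lift to [a'], [b'], [q'] by projectivity. The endomorphism
    id - (b' a' + q' p g) of [P] is killed by [g], so it factors through [K] as [s]. On [K] the term
    with [q'] disappears because g i = 0. *)
Lemma stable_retract_lift :
  short_exact i g -> short_exact i' g' -> projective P -> projective P' ->
  stable_retract W W' ->
  exists (a : {linear P -> P'}) (aK : {linear K -> K'}) (bK : {linear K' -> K})
    (s : {linear P -> K}),
  (forall x, i' (aK x) = a (i x)) /\ (forall x, x = bK (aK x) + s (i x)).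
Proof.
move=> ig ig' P_proj P'_proj [a [b [Q [p [q [Q_proj abqp]]]]]].
have [i_inj ig_exact g_surj] := ig; have [_ ig'_exact g'_surj] := ig'.
have gi0 x : g (i x) = 0 by apply/ig_exact; exists x.
have gi'0 x : g' (i' x) = 0 by apply/ig'_exact; exists x.
have [a' a'E] := P_proj _ _ g' (a \o g : {linear P -> W'}) g'_surj.
have [b' b'E] := P'_proj _ _ g (b \o g' : {linear P' -> W}) g_surj.
have [q' q'E] := Q_proj _ _ g q g_surj.
have [aK aKE] : exists aK : {linear K -> K'}, forall x, i' (aK x) = a' (i x).
  apply: (lift_to_kernel (f := a' \o i : {linear K -> P'}) ig') => x /=.
  by rewrite a'E /= gi0 linear0.
have [bK bKE] : exists bK : {linear K' -> K}, forall x, i (bK x) = b' (i' x).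
  apply: (lift_to_kernel (f := b' \o i' : {linear K' -> P}) ig) => x /=.
  by rewrite b'E /= gi'0 linear0.
pose d : {linear P -> P} := (idfun \- ((b' \o a') \+ (q' \o p \o g)) : P -> P).
have [s sE] : exists s : {linear P -> K}, forall x, i (s x) = d x.
  apply: (lift_to_kernel ig) => x /=.
  by rewrite linearB linearD /= b'E /= a'E /= q'E -abqp subrr.
exists a', aK, bK, s; split=> // x; apply: i_inj.
by rewrite linearD bKE aKE sE /= gi0 !linear0 addr0 addrC subrK.
Qed.

Lemma stable_retract_syzygy :
  short_exact i g -> short_exact i' g' -> projective P -> projective P' ->
  stable_retract W W' -> stable_retract K K'.
Proof.
move=> ig ig' P_proj P'_proj WW'.
have [_ [aK [bK [s [_ abs]]]]] := stable_retract_lift ig ig' P_proj P'_proj WW'.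
(* The error term now factors through [P] itself, by [i] and [s]. *)
by exists aK, bK, P, i, s.
Qed.

(** The lift gives f = f bK aK + f s i. The first summand extends because f bK extends along [i'];
    the second is a restriction from [P] by construction. *)
Lemma extends_along_stable_retract N :
  short_exact i g -> short_exact i' g' -> projective P -> projective P' ->
  stable_retract W W' -> extends_along i' N -> extends_along i N.
Proof.
move=> ig ig' P_proj P'_proj WW' ext' f.
have [a [aK [bK [s [aE abs]]]]] := stable_retract_lift ig ig' P_proj P'_proj WW'.
have [h hE] := ext' (f \o bK : {linear K' -> N}).
exists ((h \o a) \+ (f \o s) : {linear P -> N}) => x /=.
by rewrite {1}(abs x) linearD -aE -hE.
Qed.

End Syzygy.

Lemma standard_short_exact M :
  short_exact (val : {linear syzygy M -> free_module R M}) (free_cover M).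
Proof.
by apply: short_exact_submod => [b|]; [split=> /eqP | apply: free_cover_surjective].
Qed.

(** A cocycle kills the image of the next differential, which is the kernel of the free cover, so it
    descends to the syzygy. Extending the descended map to the free module writes the cocycle as a
    coboundary. *)
Lemma Ext_eq0 M N j :
  extends_along (val : {linear syzygy (syzygies M j) -> free_module R (syzygies M j)}) N ->
  forall e : Ext j.+1 M N, e = 0.
Proof.
move=> ext; apply: Ext_of_eq0 => c c_ker.
have c_cover x : free_cover (syzygies M j.+1) x = 0 -> c x = 0.
  by move=> /standard_d_img[y ->]; apply: c_ker.
have [f fE] := choice (@free_cover_surjective R (syzygies M j.+1)).
have cf x : c x = c (f (free_cover (syzygies M j.+1) x)).
  by apply/subr0_eq; rewrite -linearB; apply: c_cover; rewrite linearB fE subrr.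
have cf_lin : linear (c \o f).
  by move=> a x y /=; rewrite -linearP [RHS]cf linearP !fE.
have [h hE] := ext (linear_of cf_lin).
by exists h => x; rewrite cf -[LHS]/(linear_of cf_lin _) hE.
Qed.

Lemma extends_along_image P P' N (d : {linear P -> P'}) :
  (forall f : {linear P -> N}, (forall w, d w = 0 -> f w = 0) ->
     exists h : {linear P' -> N}, forall w, f w = h (d w)) ->
  extends_along (val : {linear submod (Defs.limg d) -> P'}) N.
Proof.
move=> ext f; have [d' [d'_surj d'E]] := corestriction d.
have [|h hE] := ext (f \o d' : {linear P -> N}).
  move=> w dw0; rewrite /= -[RHS](linear0 f); congr (f _); apply: val_inj.
  by apply: etrans (d'E w) _; rewrite dw0.
exists h => b; have [w <-] := d'_surj b; apply: etrans (hE w) _.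
by congr (h _); apply/esym/d'E.
Qed.

Section Resolution.
Variables (P M N : lmodType R) (aug : {linear P -> M}) (d : nat -> {linear P -> P}).
Hypothesis P_projective : projective P.
Hypothesis aug_surj : surjective aug.
Hypothesis aug_kernel : forall w, aug w = 0 <-> w \in Defs.limg (d 0).
Hypothesis d_kernel : forall n w, d n w = 0 <-> w \in Defs.limg (d n.+1).
Hypothesis d_acyclic : forall n (f : {linear P -> N}), (forall w, f (d n.+1 w) = 0) ->
  exists h : {linear P -> N}, forall w, f w = h (d n w).

(** By induction the syzygy n + 1 of the standard resolution is a stable retract of the image of
    [d n]. Maps to [N] extend from that image to [P] by [d_acyclic], and this property passes to the
    standard syzygies. *)
Lemma Ext_resolution_eq0 j (e : Ext j.+1 M N) : e = 0.
Proof.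
pose img n : lmodType R := submod (Defs.limg (d n)).
have img_exact n : exists g : {linear P -> img n},
    short_exact (val : {linear img n.+1 -> P}) g.
  have [g [g_surj gE]] := corestriction (d n); exists g.
  apply: short_exact_submod => // w; rewrite -d_kernel -gE.
  by split=> [->|gw0]; [| apply: val_inj; apply: etrans gw0 _].
have img_ext n : extends_along (val : {linear img n -> P}) N.
  apply: extends_along_image => f f0; apply: d_acyclic => w; apply: f0.
  by apply/d_kernel/asboolP; exists w.
have aug_exact : short_exact (val : {linear img 0%N -> P}) aug.
  exact: short_exact_submod.
have free_proj (W : lmodType R) : projective (free_module R W).
  exact: free_module_projective.
have retract n : stable_retract (syzygies M n.+1) (img n).
  elim: n => [|n IHn]; last have [g g_exact] := img_exact n.
    exact: (stable_retract_syzygy (standard_short_exact M) aug_exact _ _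
      (stable_retract_refl M)).
  exact: (stable_retract_syzygy (standard_short_exact (syzygies M n.+1)) g_exact _ _ IHn).
move: e; apply: Ext_eq0; case: j => [|j].
  exact: (extends_along_stable_retract (standard_short_exact M) aug_exact _ _
    (stable_retract_refl M) (img_ext 0%N)).
have [g g_exact] := img_exact j.
exact: (extends_along_stable_retract (standard_short_exact (syzygies M j.+1)) g_exact _ _
  (retract j) (img_ext j.+1)).
Qed.

End Resolution.

End Homological.

(* In the application, eps is the augmentation of R and theta the coefficient of u. *)
Section NonvanishingExt.
Variables (k R : comNzRingType) (kappa : {rmorphism k -> R}) (eps : {rmorphism R -> k}).
Variables (theta : R -> k) (u : R).
Hypothesis kappaK : cancel kappa eps.
Hypothesis theta_add : {morph theta : r r' / r + r'}.
Hypothesis theta_leibniz : forall r r', theta (r * r') = eps r * theta r' + theta r * eps r'.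
Hypothesis theta_u : theta u = 1.
Hypothesis u_sqr : u * u = 0.

(** These are the R-linear maps to k, where R acts on k through [eps]. *)
Definition residual (W : lmodType R) (chi : W -> k) : Prop :=
  forall r w w', chi (r *: w + w') = eps r * chi w + chi w'.

Lemma residual0 (W : lmodType R) (chi : W -> k) : residual chi -> chi 0 = 0.
Proof.
by move=> chi_res; have := chi_res (-1) 0 0;
  rewrite scaler0 addr0 rmorphN rmorph1 mulN1r addNr.
Qed.

Lemma free_lift_residual (W : lmodType R) (chi : W -> k) f :
  residual chi -> eps (free_lift (kappa \o chi : W -> R^o) f) = chi (free_cover W f).
Proof.
move=> chi_res; rewrite /free_cover /= /free_lift rmorph_sum /=.
elim/big_rec2: _ => [|w a b _ ->]; first by rewrite residual0.
by rewrite chi_res rmorphM /= kappaK.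
Qed.

(* A residual map W -> k lifts to the free cover, and the lift maps syzygies to ker eps,
   on which theta is residual. *)
Lemma residual_syzygy (W : lmodType R) (chi : W -> k) (g : W) :
  residual chi -> chi g = 1 -> u *: g = 0 ->
  exists (chi' : syzygy W -> k) (g' : syzygy W),
    [/\ residual chi', chi' g' = 1, u *: g' = 0 & val g' = u *: free_basis R g].
Proof.
move=> chi_res chi_g ug.
pose L : {linear free_module R W -> R^o} := free_lift (kappa \o chi : W -> R^o).
have g'_in : u *: free_basis R g \in Defs.lker (free_cover W).
  by apply/eqP; rewrite linearZ /= free_lift_basis.
exists (fun w => theta (L (val w))), (Submod g'_in); split=> [r w w'|||//].
- have -> : L (val (r *: w + w')) = r * L (val w) + L (val w') by rewrite !linearP.
  rewrite theta_add theta_leibniz [eps (L _)](free_lift_residual _ chi_res).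
  by rewrite (eqP (valP w) : free_cover W (val w) = 0) residual0 // mulr0 addr0.
- have -> : L (u *: free_basis R g) = u * L (free_basis R g) by rewrite linearZ.
  by rewrite /L /= free_lift_basis /= chi_g rmorph1 mulr1.
- by apply: val_inj; rewrite linearZ /= scalerA u_sqr scale0r.
Qed.

Lemma Ext_neq0 (N M : lmodType R) (chi : N -> k) (g : N) (s : M) j :
  residual chi -> chi g = 1 -> u *: g = 0 ->
  (forall r, eps r = 0 -> r *: s = 0) -> (forall m, s <> u *: m) ->
  exists e : Ext j.+1 N M, e <> 0.
Proof.
move=> chi_res chi_g ug s_socle s_notin.
(* A residual map with value 1 at an element killed by [u] is passed from [N] to each of its
   syzygies in turn. *)
have [chi_j [g_j [chi_j_res chi_gj ugj]]] :
    exists (chi' : syzygies N j -> k) (g' : syzygies N j),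
      [/\ residual chi', chi' g' = 1 & u *: g' = 0].
  elim: j => [|j [chi' [g' [chi'_res chi_g' ug']]]]; first by exists chi, g.
  by have [chi2 [g2 [? ? ? _]]] := residual_syzygy chi'_res chi_g' ug'; exists chi2, g2.
have [chi' [g' [chi'_res chi_g' _ g'E]]] := residual_syzygy chi_j_res chi_gj ugj.
(* Linearity of [c] holds because r and [kappa (eps r)] act alike on the socle element [s]. *)
pose c (f : standard_obj N j.+1) := kappa (chi' (free_cover (syzygies N j.+1) f)) *: s.
have c_lin : linear c.
  move=> r f f'; rewrite /c linearP chi'_res rmorphD rmorphM scalerDl -scalerA; congr (_ + _).
  set b := kappa _ *: s.
  apply/subr0_eq; rewrite -scalerBl /b scalerA mulrC -scalerA s_socle ?scaler0 //.
  by rewrite rmorphB /= kappaK subrr.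
apply: (@Ext_of_neq0 _ _ (standard_resolution N) _ _ (linear_of c_lin)) => [f|[h hE]].
  rewrite /= /c; have -> : free_cover (syzygies N j.+1) (standard_d N j.+1 f) = 0.
    by apply/standard_d_img; exists f.
  by rewrite residual0 // rmorph0 scale0r.
(* At the basis element of [g'] the map [c] takes the value [s], while the differential there is u
   e, with e the basis element of [g_j]. Hence s = h (u e) = u (h e). *)
apply: (s_notin (h (free_basis R g_j))).
have cover_g' : free_cover (syzygies N j.+1) (free_basis R g') = g'.
  exact: free_lift_basis.
have := hE (free_basis R g'); rewrite /= /c cover_g' chi_g' rmorph1 scale1r => ->.
by rewrite -linearZ -g'E -[X in val X]cover_g'.
Qed.

End NonvanishingExt.

(** * Spans and free modules of rank two *)

Section Spans.
Variables (R : comNzRingType) (V : lmodType R).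

Lemma mem_lspan (s : seq V) e : e \in s -> e \in lspan s.
Proof.
move=> e_in; apply/asboolP.
have e_lt : (index e s < size s)%N by rewrite index_mem.
exists (fun i => (i == Ordinal e_lt)%:R).
rewrite (bigD1 (Ordinal e_lt)) //= eqxx scale1r nth_index // big1 ?addr0 // => i.
by move=> /negPf->; rewrite scale0r.
Qed.

Lemma pair_basis (w : (R^o * R^o)%type) : w = w.1 *: (1, 0) + w.2 *: (0, 1).
Proof.
case: w => w1 w2; congr pair.
  by rewrite -[RHS]/(w1 * 1 + w2 * 0) mulr1 mulr0 addr0.
by rewrite -[RHS]/(w1 * 0 + w2 * 1) mulr1 mulr0 add0r.
Qed.

Lemma linear_pair (f : {linear (R^o * R^o)%type -> V}) w :
  f w = w.1 *: f (1, 0) + w.2 *: f (0, 1).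
Proof. by rewrite {1}(pair_basis w) linearD !linearZ. Qed.

Lemma pair_lift (a b : V) :
  exists h : {linear (R^o * R^o)%type -> V}, forall w, h w = w.1 *: a + w.2 *: b.
Proof.
have h_lin : linear (fun w : (R^o * R^o)%type => w.1 *: a + w.2 *: b).
  by move=> c w w' /=; rewrite !scalerDl scalerDr !scalerA addrACA.
by exists (linear_of h_lin).
Qed.

End Spans.

Lemma pair_projective (R : comNzRingType) : projective (R^o * R^o : lmodType R)%type.
Proof.
move=> A B g f g_surj.
have [[a1 a1E] [a2 a2E]] := (g_surj (f (1, 0)), g_surj (f (0, 1))).
have [h hE] := pair_lift a1 a2.
by exists h => w; rewrite hE linearD !linearZ /= a1E a2E -linear_pair.
Qed.

Lemma cV2E (A : pzRingType) (c : 'cV[A]_2) :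
  c = c 0 0 *: delta_mx 0 0 + c 1 0 *: delta_mx 1 0.
Proof.
apply/colP => i; rewrite !mxE; case: i => -[|[|//]] i_lt;
  rewrite ?mulr1 ?mulr0 ?addr0 ?add0r; congr (c _ _); exact: val_inj.
Qed.

(** * The Gorenstein algebra of a cubic form *)

Section CubicAlgebra.
Variable k : fieldType.

(* The coordinates dT, ..., dZ refer to the basis of the degree 2 part which is dual to
   T, ..., Z.  It consists of ty, vz, uz, tv, vy, uv; the basis of degree 3 is uvz. *)
Record cubic_algebra (al : k) := Cubic {
  deg0 : k;
  cT : k; cU : k; cV : k; cX : k; cY : k; cZ : k;
  dT : k; dU : k; dV : k; dX : k; dY : k; dZ : k;
  deg3 : k }.

Variable al : k.
Arguments Cubic {al}.
Local Notation cubic := (cubic_algebra al).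

HB.instance Definition _ := gen_eqMixin cubic.
HB.instance Definition _ := gen_choiceMixin cubic.

Definition cubic_zero : cubic := Cubic 0 0 0 0 0 0 0 0 0 0 0 0 0 0.

Definition cubic_map2 (f : k -> k -> k) (p q : cubic) : cubic :=
  Cubic (f (deg0 p) (deg0 q))
    (f (cT p) (cT q)) (f (cU p) (cU q)) (f (cV p) (cV q))
    (f (cX p) (cX q)) (f (cY p) (cY q)) (f (cZ p) (cZ q))
    (f (dT p) (dT q)) (f (dU p) (dU q)) (f (dV p) (dV q))
    (f (dX p) (dX q)) (f (dY p) (dY q)) (f (dZ p) (dZ q))
    (f (deg3 p) (deg3 q)).

Definition cubic_add : cubic -> cubic -> cubic := cubic_map2 +%R.
Definition cubic_opp (p : cubic) : cubic := cubic_map2 (fun a _ => - a) p p.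

Lemma cubic_addA : associative cubic_add.
Proof. by move=> p q r; congr Cubic; apply: addrA. Qed.

Lemma cubic_addC : commutative cubic_add.
Proof. by move=> p q; congr Cubic; apply: addrC. Qed.

Lemma cubic_add0 : left_id cubic_zero cubic_add.
Proof. by case=> *; congr Cubic; apply: add0r. Qed.

Lemma cubic_addN : left_inverse cubic_zero cubic_opp cubic_add.
Proof. by case=> *; congr Cubic; apply: addNr. Qed.

HB.instance Definition _ := GRing.isZmodule.Build cubic
  cubic_addA cubic_addC cubic_add0 cubic_addN.

Definition cubic_one : cubic := Cubic 1 0 0 0 0 0 0 0 0 0 0 0 0 0.

(* The product of linear forms is polarized from the cubic form (in divided powers)
   T^2 Y - (1 + al) T^2 Z + T V X - al T X Z + V X^2 + V Y^2 + X^3 - al X^2 Z - Y^2 Z + U V Z,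
   the Macaulay inverse system of I. *)
Definition cubic_mul (p q : cubic) : cubic :=
  let: Cubic p0 pT pU pV pX pY pZ eT eU eV eX eY eZ p3 := p in
  let: Cubic q0 qT qU qV qX qY qZ fT fU fV fX fY fZ q3 := q in
  Cubic (p0 * q0)
    (p0 * qT + pT * q0) (p0 * qU + pU * q0) (p0 * qV + pV * q0)
    (p0 * qX + pX * q0) (p0 * qY + pY * q0) (p0 * qZ + pZ * q0)
    (p0 * fT + eT * q0 + (pT * qY + pY * qT) - (1 + al) * (pT * qZ + pZ * qT)
      + (pV * qX + pX * qV) - al * (pX * qZ + pZ * qX))
    (p0 * fU + eU * q0 + (pV * qZ + pZ * qV))
    (p0 * fV + eV * q0 + (pT * qX + pX * qT) + pX * qX + pY * qY + (pU * qZ + pZ * qU))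
    (p0 * fX + eX * q0 + (pT * qV + pV * qT) - al * (pT * qZ + pZ * qT)
      + (pV * qX + pX * qV) + pX * qX - al * (pX * qZ + pZ * qX))
    (p0 * fY + eY * q0 + pT * qT + (pV * qY + pY * qV) - (pY * qZ + pZ * qY))
    (p0 * fZ + eZ * q0 - (1 + al) * (pT * qT) - al * (pT * qX + pX * qT)
      - al * (pX * qX) - pY * qY + (pU * qV + pV * qU))
    (p0 * q3 + p3 * q0 + (pT * fT + eT * qT) + (pU * fU + eU * qU) + (pV * fV + eV * qV)
      + (pX * fX + eX * qX) + (pY * fY + eY * qY) + (pZ * fZ + eZ * qZ)).

(** The essential case is a product of three linear forms, where both bracketings give the
    polarization of the cubic form, which is symmetric. *)
Lemma cubic_mulA : associative cubic_mul.
Proof.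
case=> ? ? ? ? ? ? ? ? ? ? ? ? ? ? [? ? ? ? ? ? ? ? ? ? ? ? ? ?] [*].
by congr Cubic; ring.
Qed.

Lemma cubic_mulC : commutative cubic_mul.
Proof. by case=> ? ? ? ? ? ? ? ? ? ? ? ? ? ? [*]; congr Cubic; ring. Qed.

Lemma cubic_mul1 : left_id cubic_one cubic_mul.
Proof. by case=> *; congr Cubic; ring. Qed.

Lemma cubic_mulDl : left_distributive cubic_mul +%R.
Proof.
case=> ? ? ? ? ? ? ? ? ? ? ? ? ? ? [? ? ? ? ? ? ? ? ? ? ? ? ? ?] [*].
by congr Cubic; rewrite /=; ring.
Qed.

Lemma cubic_one_neq0 : cubic_one != 0.
Proof. by apply/eqP => /(congr1 (@deg0 al))/eqP; rewrite oner_eq0. Qed.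

HB.instance Definition _ := GRing.Zmodule_isComNzRing.Build cubic
  cubic_mulA cubic_mulC cubic_mul1 cubic_mulDl cubic_one_neq0.

Lemma cubicP (p q : cubic) :
  deg0 p = deg0 q -> cT p = cT q -> cU p = cU q -> cV p = cV q -> cX p = cX q ->
  cY p = cY q -> cZ p = cZ q -> dT p = dT q -> dU p = dU q -> dV p = dV q ->
  dX p = dX q -> dY p = dY q -> dZ p = dZ q -> deg3 p = deg3 q -> p = q.
Proof.
case: p q => ? ? ? ? ? ? ? ? ? ? ? ? ? ? [? ? ? ? ? ? ? ? ? ? ? ? ? ?] /=.
by do 14 move=> ->.
Qed.

Section Realization.
Variables (B : comNzRingType) (kappa : {rmorphism k -> B}) (t u v x y z : B).

Definition realize (p : cubic) : B :=
  kappa (deg0 p) + (kappa (cT p) * t + kappa (cU p) * u + kappa (cV p) * v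
    + kappa (cX p) * x + kappa (cY p) * y + kappa (cZ p) * z)
  + (kappa (dT p) * (t * y) + kappa (dU p) * (v * z) + kappa (dV p) * (u * z)
    + kappa (dX p) * (t * v) + kappa (dY p) * (v * y) + kappa (dZ p) * (u * v))
  + kappa (deg3 p) * (u * v * z).

Let a := kappa al.

(** The hypotheses are the fifteen quadrics, each solved for one monomial. They reduce every
    quadratic monomial to the six in the basis, so products in [B] follow the multiplication table
    of the cubic form. *)
Lemma realizeM :
  [/\ z ^+ 2 = 0, u * z = t * x + a * (u * v), u ^+ 2 = 0, y * z = - (v * y) & u * y = 0] ->
  [/\ y ^+ 2 = t * x + (a - 1) * (u * v), x * z = - a * (v * x), u * x = 0, x * y = 0
    & x ^+ 2 = t * x + t * v] ->
  [/\ t * z = - (t * y) - a * (v * x), t * u = 0, t * y = v * x - t * v,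
    t ^+ 2 = v * y - (a + 1) * (u * v) & v ^+ 2 = 0] ->
  {morph realize : p q / p * q}.
Proof.
move=> [zz uz uu yz uy] [yy xz ux xy xx] [tz tu ty tt vv].
have vx : v * x = t * y + t * v by rewrite ty subrK.
have tx : t * x = u * z - a * (u * v) by rewrite uz addrK.
have tv : t * v = v * x - t * y by rewrite vx addrAC subrr add0r.
(* A cubic consequence of the quadrics: tvy = (vx - ty)y = -ty^2 = -t^2 x = 0, using xy = tu = ux =
   0. *)
have tvy : t * v * y = 0 by ring : tv xy yy tu tt ux.
(* Afterwards the right-hand sides of the rules given to [ring] contain only basis monomials. *)
rewrite vx ?tx in xz xx tz; rewrite tx in yy xx.
case=> p0 pT pU pV pX pY pZ eT eU eV eX eY eZ p3.
case=> q0 qT qU qV qX qY qZ fT fU fV fX fY fZ q3.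
rewrite /realize /=.
ring : zz uu yz uy yy xz ux xy xx tz tu tt vv tvy vx tx.
Qed.

Lemma realizeB : {morph realize : p q / p - q}.
Proof. by move=> p q; rewrite /realize /=; ring. Qed.

Lemma realize1 : realize 1 = 1.
Proof. by rewrite /realize /= !rmorph0 !mul0r !addr0 rmorph1. Qed.

End Realization.

Definition cubic_const (c : k) : cubic := Cubic c 0 0 0 0 0 0 0 0 0 0 0 0 0.

Lemma cubic_const_zmod_morphism : zmod_morphism cubic_const.
Proof. by move=> a b; congr Cubic; rewrite subr0. Qed.

Lemma cubic_const_monoid_morphism : monoid_morphism cubic_const.
Proof. by split=> [|a b]; congr Cubic; ring. Qed.

HB.instance Definition _ :=
  GRing.isZmodMorphism.Build k cubic cubic_const cubic_const_zmod_morphism.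
HB.instance Definition _ :=
  GRing.isMonoidMorphism.Build k cubic cubic_const cubic_const_monoid_morphism.

Definition cubic_gens : seq cubic := [::
  Cubic 0 1 0 0 0 0 0 0 0 0 0 0 0 0; Cubic 0 0 1 0 0 0 0 0 0 0 0 0 0 0;
  Cubic 0 0 0 1 0 0 0 0 0 0 0 0 0 0; Cubic 0 0 0 0 1 0 0 0 0 0 0 0 0 0;
  Cubic 0 0 0 0 0 1 0 0 0 0 0 0 0 0; Cubic 0 0 0 0 0 0 1 0 0 0 0 0 0 0].

Definition coords : {mpoly k[6]} -> cubic :=
  mmap cubic_const (fun i : 'I_6 => cubic_gens`_i).

HB.instance Definition _ := GRing.RMorphism.on coords.

Lemma coordsX (i : 'I_6) : coords 'X_i = cubic_gens`_i.
Proof. by rewrite /coords mmapX mmap1U. Qed.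

Lemma coordsC c : coords c%:MP = cubic_const c.
Proof. exact: mmapC. Qed.

Lemma coords_quadrics q : q \in quadrics al -> coords q = 0.
Proof.
rewrite !inE; do ![case/orP=> [/eqP->|] | move/eqP=> ->].
all: rewrite -?mul_mpolyC ?(rmorphD, rmorphN, rmorphB, rmorphM, rmorphXn) /=.
all: rewrite ?(rmorphN, rmorphM, coordsX, coordsC) /=.
all: apply: cubicP; rewrite /=; ring.
Qed.

Lemma coords_ideal p : p \in ideal_I al -> coords p = 0.
Proof.
move=> /asboolP[c ->]; rewrite rmorph_sum big1 // => i _.
by rewrite [LHS]rmorphM /= [X in _ * X]coords_quadrics ?mulr0 // mem_nth.
Qed.

End CubicAlgebra.
Arguments Cubic {k al}.

(** * The kernel of D_a^T in coordinates *)

Section CubicKernel.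
Variables (k : fieldType) (al : k).
Local Notation cubic := (cubic_algebra al).
Local Notation gen i := ((cubic_gens al)`_i).
Local Notation const := (cubic_const al).

(* p and q agree up to degree 1 with y_0 (v, y) + z_0 (a al x, z), where y_0 and z_0 are the
   coefficients of y and z in q; no other kernel elements occur if 1 - a is invertible. *)
Lemma cubic_kernel_high (a : k) (p q : cubic) :
  al != 0 -> 1 - a * al != 0 ->
  deg0 p = 0 -> deg0 q = 0 ->
  cT p = 0 -> cU p = 0 -> cV p = cY q -> cX p = a * al * cZ q -> cY p = 0 -> cZ p = 0 ->
  cT q = 0 -> cU q = 0 -> cV q = 0 -> cX q = 0 ->
  dV p = - a * dX q -> dZ q = - dY p ->
  exists r s : cubic,
    p = r * gen 2 + s * (const (a * al) * gen 3) /\ q = r * gen 4 + s * gen 5.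
Proof.
case: p q => [p0 pT pU pV pX pY pZ eT eU eV eX eY eZ p3].
case=> [q0 qT qU qV qX qY qZ fT fU fV fX fY fZ q3] /= al0 b1.
do 14 move=> ->.
(* The constant terms of r and s are [qY] and [qZ], and their linear coefficients solve the system
   given by the quadratic coordinates of p and q. Division by 1 - a al enters only through [sT]. In
   r, [p3] and [q3] sit at the coordinates dual to V and Y, so that multiplication by v and y
   returns them in degree 3. *)
pose sT := (eX - eT - fT + fX + a * fX) / (1 - a * al).
exists (Cubic qY (fT + sT - fX) (eZ - a * al * fX) (fY + eU) (eT - a * al * fU) eY eU
  0 0 p3 0 q3 0 0).
exists (Cubic qZ sT (fV - eY) fU (- fX / al - sT) 0 0 0 0 0 0 0 0 0).
rewrite /sT; split; apply: cubicP => /=; field.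
all: by rewrite ?al0 ?b1.
Qed.

(** The equations in degree d + 1 constrain the parts of p and q in degree d. Degrees 1 and 2 fix
    the terms of degree at most one; degree 3 gives the last two conditions of
    [cubic_kernel_high]. *)
Lemma cubic_kernel (a : k) (p q : cubic) :
  al != 0 -> a != 0 -> 1 - a != 0 -> 1 - a * al != 0 ->
  gen 2 * p + const a * gen 3 * q = 0 -> gen 4 * p + gen 5 * q = 0 ->
  exists r s : cubic,
    p = r * gen 2 + s * (const (a * al) * gen 3) /\ q = r * gen 4 + s * gen 5.
Proof.
move=> al0 a0 a1 b1 E1 E2.
have cancel2 c d : c != 0 -> c * d = 0 :> k -> d = 0.
  by move=> c0 /eqP; rewrite mulf_eq0 (negPf c0) => /eqP.
case: p q E1 E2 => [p0 pT pU pV pX pY pZ eT eU eV eX eY eZ p3].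
case=> [q0 qT qU qV qX qY qZ fT fU fV fX fY fZ q3] E1 E2.
have p0E : p0 = 0 by apply: etrans (congr1 (@cV k al) E1); rewrite /=; ring.
have q0E : q0 = 0 by apply: etrans (congr1 (@cZ k al) E2); rewrite /=; ring.
have pZE : pZ = 0 by apply: etrans (congr1 (@dU k al) E1); rewrite /= p0E q0E; ring.
have pYE : pY = 0 by apply: etrans (congr1 (@dY k al) E1); rewrite /= p0E q0E; ring.
have qVE : qV = 0 by apply: etrans (congr1 (@dU k al) E2); rewrite /= p0E q0E; ring.
have qTX : qT + qX = 0.
  by apply: (cancel2 _ _ a0); apply: etrans (congr1 (@dV k al) E1); rewrite /= p0E q0E; ring.
have qXE : qX = - qT by apply/eqP; rewrite -addr_eq0 addrC qTX.
have qYE : pV = qY.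
  by apply/subr0_eq; apply: etrans (congr1 (@dY k al) E2); rewrite /= p0E q0E pZE; ring.
have pTE : pT = qT.
  by apply/subr0_eq; apply: etrans (congr1 (@dT k al) E2); rewrite /= p0E q0E qXE; ring.
have pXE : pX = a * al * qZ.
  by apply/subr0_eq; apply: etrans (congr1 (@dT k al) E1); rewrite /= p0E q0E qVE; ring.
(* With the relations found so far the [dX] coordinate reads (1 - a) qT = 0: this excludes the extra
   kernel class that appears for a = 1. *)
have qT0 : qT = 0.
  apply: (cancel2 _ _ a1); apply: etrans (congr1 (@dX k al) E1).
  by rewrite /= p0E q0E pXE pTE qVE qXE; ring.
have pUE : pU = 0.
  by apply: etrans (congr1 (@dZ k al) E1); rewrite /= p0E q0E pTE qXE qT0; ring.
have qUE : qU = 0.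
  by apply: etrans (congr1 (@dV k al) E2); rewrite /= p0E q0E pTE qXE pYE qT0; ring.
apply: cubic_kernel_high => //=.
- by rewrite pTE.
- by rewrite qXE qT0 oppr0.
- by apply/subr0_eq; apply: etrans (congr1 (@deg3 k al) E1); rewrite /=; ring.
- by apply/subr0_eq; apply: etrans (congr1 (@deg3 k al) E2); rewrite /=; ring.
Qed.

End CubicKernel.

(** * The ring R and its modules M and N *)

Lemma mpoly_rmorph_ext (n : nat) (A B : nzRingType) (f g : {rmorphism {mpoly A[n]} -> B}) :
  (forall c, f c%:MP = g c%:MP) -> (forall i, f 'X_i = g 'X_i) -> f =1 g.
Proof.
move=> fgC fgX p; rewrite [p]mpolyE !rmorph_sum; apply: eq_bigr => m _.
rewrite -mul_mpolyC !rmorphM fgC mpolyXE_id !rmorph_prod; congr (_ * _).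
by apply: eq_bigr => i _; rewrite !rmorphXn fgX.
Qed.

Section RingCoordinates.
Variables (k : fieldType) (al : k).

Notation P := {mpoly k[6]}.
Notation R := (ring_R al).
Notation var j := ('X_(@Ordinal 6 j isT) : P).
Notation t := (cls al (var 0)).
Notation u := (cls al (var 1)).
Notation v := (cls al (var 2)).
Notation x := (cls al (var 3)).
Notation y := (cls al (var 4)).
Notation z := (cls al (var 5)).
Notation R2 := (R^o * R^o)%type.
Notation N := (module_N al).
Notation M := (module_M al).

HB.instance Definition _ :=
  GRing.RMorphism.copy (cls al) (\pi_(Quotient.quot (ideal_I al))).

Definition ring_scalar : {rmorphism k -> R} := (cls al \o @mpolyC 6 k : k -> R).

Lemma cls_surj (r : R) : exists p, r = cls al p.
Proof. by exists (repr r); rewrite /cls reprK. Qed.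

Lemma cls_eq0 p : p \in ideal_I al -> cls al p = 0.
Proof.
rewrite -[p in p \in _]subr0 Quotient.idealrBE => /eqP p0.
by apply: etrans p0 _; apply: (rmorph0 (cls al)).
Qed.

Lemma ideal_of_cls p q : cls al p = cls al q -> p - q \in ideal_I al.
Proof. by move=> pq; rewrite Quotient.idealrBE; apply/eqP. Qed.

Lemma cls_quadrics q : q \in quadrics al -> cls al q = 0.
Proof. by move=> q_in; apply/cls_eq0/(@mem_lspan _ P^o). Qed.

Lemma clsZ a p : cls al (a *: p) = ring_scalar a * cls al p.
Proof. by rewrite -mul_mpolyC rmorphM. Qed.

Notation iota := (@realize k al R ring_scalar t u v x y z).

Lemma iotaM : {morph iota : p q / p * q}.
Proof.
have rel i : (i < 15)%N -> cls al (quadrics al)`_i = 0.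
  by move=> ?; apply/cls_quadrics/mem_nth.
apply: realizeM; split.
(* The goals arise in the order of [quadrics]. *)
all: [> have := rel 0 isT | have := rel 1 isT | have := rel 2 isT | have := rel 3 isT
  | have := rel 4 isT | have := rel 5 isT | have := rel 6 isT | have := rel 7 isT
  | have := rel 8 isT | have := rel 9 isT | have := rel 10 isT | have := rel 11 isT
  | have := rel 12 isT | have := rel 13 isT | have := rel 14 isT].
all: rewrite /= -?mul_mpolyC ?(rmorphD, rmorphB, rmorphN, rmorphM, rmorphXn, rmorph1).
all: try by [].
all: move=> rel0; apply/eqP; rewrite -subr_eq0 -[X in _ == X]rel0; apply/eqP; ring.
Qed.

Lemma iota_monoid_morphism : monoid_morphism iota.
Proof. by split; [exact: realize1 | exact: iotaM]. Qed.

HB.instance Definition _ := GRing.isZmodMorphism.Build (cubic_algebra al) R iota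
  (@realizeB k al R ring_scalar t u v x y z).
HB.instance Definition _ := GRing.isMonoidMorphism.Build (cubic_algebra al) R iota
  iota_monoid_morphism.

Lemma iota_coords p : iota (coords al p) = cls al p.
Proof.
apply: (mpoly_rmorph_ext (f := iota \o coords al : P -> R) (g := cls al)) => [c|i] /=.
  by rewrite coordsC /realize /= rmorph0 !mul0r !addr0.
rewrite coordsX /realize; case: i => -[|[|[|[|[|[|//]]]]]] i_lt /=.
all: rewrite !rmorph0 !mul0r !(add0r, addr0) rmorph1 mul1r.
all: by congr (cls al 'X_[U_(_)]); apply: val_inj.
Qed.

(** The choice of representative is immaterial since [coords] kills the ideal. By [ring_coordK] the
    map is injective, so identities in R can be checked on coordinates. *)
Definition ring_coord (r : R) : cubic_algebra al := coords al (repr r).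

Lemma ring_coord_cls p : ring_coord (cls al p) = coords al p.
Proof.
apply/eqP; rewrite -subr_eq0 -rmorphB; apply/eqP/coords_ideal/ideal_of_cls.
by rewrite /cls reprK.
Qed.

Lemma ring_coord_scalar c : ring_coord (ring_scalar c) = cubic_const al c.
Proof. by rewrite ring_coord_cls coordsC. Qed.

Lemma ring_coordK : cancel ring_coord iota.
Proof. by move=> r; have [p ->] := cls_surj r; rewrite ring_coord_cls iota_coords. Qed.

Lemma ring_coord_zmod_morphism : zmod_morphism ring_coord.
Proof.
move=> r s; have [[p ->] [q ->]] := (cls_surj r, cls_surj s).
by rewrite -rmorphB !ring_coord_cls rmorphB.
Qed.

Lemma ring_coord_monoid_morphism : monoid_morphism ring_coord.
Proof.
split=> [|r s]; first by rewrite -(rmorph1 (cls al)) ring_coord_cls rmorph1.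
have [[p ->] [q ->]] := (cls_surj r, cls_surj s).
by rewrite -rmorphM !ring_coord_cls rmorphM.
Qed.

HB.instance Definition _ := GRing.isZmodMorphism.Build R (cubic_algebra al) ring_coord
  ring_coord_zmod_morphism.
HB.instance Definition _ := GRing.isMonoidMorphism.Build R (cubic_algebra al) ring_coord
  ring_coord_monoid_morphism.

Lemma ring_coordD : {morph ring_coord : r s / r + s}.
Proof. exact: rmorphD. Qed.

Lemma ring_coordB : {morph ring_coord : r s / r - s}.
Proof. exact: rmorphB. Qed.

Lemma ring_coordM : {morph ring_coord : r s / r * s}.
Proof. exact: rmorphM. Qed.

Lemma ring_coord_gen (i : 'I_6) : ring_coord (cls al 'X_i) = (cubic_gens al)`_i.
Proof. by rewrite ring_coord_cls coordsX. Qed.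

Definition eps (r : R) : k := deg0 (ring_coord r).
Definition theta (r : R) : k := cU (ring_coord r).
(** On N = k[x]/(x^2) this is the coefficient of x: modulo the relations of N, each of v, y, z
    becomes x, while t and u vanish. *)
Definition lambda (r : R) : k :=
  cV (ring_coord r) + cX (ring_coord r) + cY (ring_coord r) + cZ (ring_coord r).

Lemma eps_zmod_morphism : zmod_morphism eps.
Proof. by move=> r s; rewrite /eps rmorphB. Qed.

Lemma deg0M (p q : cubic_algebra al) : deg0 (p * q) = deg0 p * deg0 q.
Proof. by case: p q => ? ? ? ? ? ? ? ? ? ? ? ? ? ? []. Qed.

Lemma eps_monoid_morphism : monoid_morphism eps.
Proof. by split=> [|r s]; rewrite /eps ?rmorph1 // rmorphM deg0M. Qed.

HB.instance Definition _ := GRing.isZmodMorphism.Build R k eps eps_zmod_morphism.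
HB.instance Definition _ := GRing.isMonoidMorphism.Build R k eps eps_monoid_morphism.

Lemma epsD : {morph eps : r s / r + s}.
Proof. exact: rmorphD. Qed.

Lemma epsB : {morph eps : r s / r - s}.
Proof. exact: rmorphB. Qed.

Lemma epsM : {morph eps : r s / r * s}.
Proof. exact: rmorphM. Qed.

Lemma scalarK : cancel ring_scalar eps.
Proof. by move=> c; rewrite /eps ring_coord_scalar. Qed.

Lemma thetaD : {morph theta : r s / r + s}.
Proof. by move=> r s; rewrite /theta ring_coordD. Qed.

Lemma theta_leibniz r s : theta (r * s) = eps r * theta s + theta r * eps s.
Proof.
rewrite /theta /eps ring_coordM.
by case: (ring_coord r) (ring_coord s) => ? ? ? ? ? ? ? ? ? ? ? ? ? ? [].
Qed.

Lemma lambdaD : {morph lambda : r s / r + s}.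
Proof. by move=> r s; rewrite /lambda ring_coordD /=; ring. Qed.

Lemma lambda_leibniz r s : lambda (r * s) = eps r * lambda s + lambda r * eps s.
Proof.
rewrite /lambda /eps ring_coordM.
by case: (ring_coord r) (ring_coord s) => ? ? ? ? ? ? ? ? ? ? ? ? ? ? [*] /=; ring.
Qed.

Lemma eps_eq0_decomp r : eps r = 0 -> exists r1 r2 r3 r4 r5 r6,
  r = t * r1 + u * r2 + v * r3 + x * r4 + y * r5 + z * r6.
Proof.
rewrite /eps -{2}[r]ring_coordK /realize.
case: (ring_coord r) => c0 c1 c2 c3 c4 c5 c6 e1 e2 e3 e4 e5 e6 c7 /= ->.
(* Each basis monomial of positive degree is assigned to one of the variables dividing it. *)
exists (ring_scalar c1 + ring_scalar e1 * y + ring_scalar e4 * v).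
exists (ring_scalar c2 + ring_scalar e3 * z + ring_scalar e6 * v + ring_scalar c7 * v * z).
exists (ring_scalar c3 + ring_scalar e2 * z + ring_scalar e5 * y).
exists (ring_scalar c4), (ring_scalar c5), (ring_scalar c6).
by rewrite rmorph0; ring.
Qed.

(* For a = al this is d_0^*, where (w1, w2) stands for the linear form c |-> w1 c_1 + w2 c_2. *)
Definition dual_d_fun (a : R) (w : R2) : R2 :=
  (v * w.1 + a * x * w.2, y * w.1 + z * w.2).

Lemma dual_d_linear a : linear (dual_d_fun a).
Proof.
move=> r [w1 w2] [w1' w2']; congr pair.
  rewrite -[LHS]/(v * (r * w1 + w1') + a * x * (r * w2 + w2')).
  by rewrite -[RHS]/(r * (v * w1 + a * x * w2) + (v * w1' + a * x * w2')); ring.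
rewrite -[LHS]/(y * (r * w1 + w1') + z * (r * w2 + w2')).
by rewrite -[RHS]/(r * (y * w1 + z * w2) + (y * w1' + z * w2')); ring.
Qed.

Definition dual_d (a : k) : {linear R2 -> R2} := linear_of (dual_d_linear (ring_scalar a)).

(** The entries of the product matrix are v^2 + a xy, a (al vx + xz), vy + yz and a al xy + z^2, all
    zero by the quadrics. *)
Lemma dual_d_dual_d a w : dual_d a (dual_d (a * al) w) = 0.
Proof.
case: w => r s; congr pair; apply: (can_inj (ring_coordK)).
all: rewrite /= !(ring_coordD, ring_coordM) !ring_coord_gen !ring_coord_scalar rmorph0.
all: case: (ring_coord r) (ring_coord s) => ? ? ? ? ? ? ? ? ? ? ? ? ? ? [*].
all: by apply: cubicP => /=; ring.
Qed.

Lemma dual_d_preimage (a : k) (p q : R) (r s : cubic_algebra al) :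
  ring_coord p = r * (cubic_gens al)`_2 + s * (cubic_const al a * (cubic_gens al)`_3) ->
  ring_coord q = r * (cubic_gens al)`_4 + s * (cubic_gens al)`_5 ->
  (p, q) = dual_d a (iota r, iota s).
Proof.
have iota_gen (i : 'I_6) : iota (cubic_gens al)`_i = cls al 'X_i.
  by rewrite -coordsX iota_coords.
have iota_const : iota (cubic_const al a) = ring_scalar a by rewrite -coordsC iota_coords.
have iotaD : {morph iota : c d / c + d} by exact: rmorphD.
move=> pE qE; rewrite -[p]ring_coordK -[q]ring_coordK pE qE; congr pair.
  rewrite iotaD !iotaM iota_const (iota_gen (@Ordinal 6 2 isT)).
  by rewrite (iota_gen (@Ordinal 6 3 isT)) /= mulrC [_ * iota s]mulrC.
rewrite iotaD !iotaM (iota_gen (@Ordinal 6 4 isT)).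
by rewrite (iota_gen (@Ordinal 6 5 isT)) /= mulrC [iota s * _]mulrC.
Qed.

Lemma dual_d_kernel (a : k) w :
  al != 0 -> a != 0 -> 1 - a != 0 -> 1 - a * al != 0 -> dual_d a w = 0 ->
  exists w', w = dual_d (a * al) w'.
Proof.
case: w => p q al0 a0 a1 b1 pq0.
have p0 : v * p + ring_scalar a * x * q = 0 := congr1 fst pq0.
have q0 : y * p + z * q = 0 := congr1 snd pq0.
have := congr1 ring_coord q0; have := congr1 ring_coord p0.
rewrite !(ring_coordD, ring_coordM) !ring_coord_gen ring_coord_scalar rmorph0 => E1 E2.
have [r [s [pE qE]]] := cubic_kernel al0 a0 a1 b1 E1 E2.
by exists (iota r, iota s); apply: dual_d_preimage.
Qed.

(** The pair (t, t - x) lies in the kernel of D_1^T. Multiplied by r in the maximal ideal it has no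
    terms of degree at most one, so [cubic_kernel_high] at a = 1 places it in the image of
    D_al^T. *)
Lemma socle_preimage r : al != 0 -> 1 - al != 0 -> eps r = 0 ->
  exists w, (r * t, r * (t - x)) = dual_d al w.
Proof.
move=> al0 al1 r0.
have [] := @cubic_kernel_high k al 1 (ring_coord (r * t)) (ring_coord (r * (t - x))) al0.
- by rewrite mul1r.
all: rewrite ?ring_coordM ?ring_coordB ?ring_coord_gen.
all: try by move: r0; rewrite /eps;
  case: (ring_coord r) => ? ? ? ? ? ? ? ? ? ? ? ? ? ? /= ->; ring.
move=> p [q]; rewrite mul1r => -[pE qE]; exists (iota p, iota q).
by apply: dual_d_preimage; rewrite ?ring_coordM ?ring_coordB ?ring_coord_gen.
Qed.

Lemma u_sqr0 : u * u = 0.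
Proof.
apply: (can_inj (ring_coordK)); rewrite ring_coordM !ring_coord_gen rmorph0.
by apply: cubicP => /=; ring.
Qed.

Lemma tty_neq0 : t * t * y != 0.
Proof.
apply/eqP => /(congr1 ring_coord); rewrite !ring_coordM !ring_coord_gen rmorph0.
move=> /(congr1 (@deg3 k al))/eqP; rewrite /=.
by rewrite !(mul0r, mulr0, add0r, addr0, mul1r, subr0, oppr0) oner_eq0.
Qed.

Lemma tty_dual_d w : t * y * (dual_d al w).1 = 0.
Proof.
case: w => p q; apply: (can_inj (ring_coordK)).
rewrite /= !(ring_coordD, ring_coordM) !ring_coord_gen ring_coord_scalar rmorph0.
case: (ring_coord p) (ring_coord q) => ? ? ? ? ? ? ? ? ? ? ? ? ? ? [*].
by apply: cubicP => /=; ring.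
Qed.

(** * The module N *)

Definition relN : seq R^o := [:: t; u; v - x; y - x; z - x].

Definition piN : {linear R^o -> N} := @lquot_pi R R^o (lspan relN).

Lemma piN_surj n : exists r, n = piN r.
Proof. by exists (repr n); rewrite /piN /= lquot_reprK. Qed.

Lemma relN_act i (n : N) : (i < 5)%N -> (relN`_i : R) *: n = 0.
Proof.
move=> i5; have [r ->] := piN_surj n; rewrite -linearZ -[RHS](linear0 piN).
apply/lquot_piP; rewrite subr0 (_ : _ *: r = r *: relN`_i); last exact: mulrC.
by apply/rpredZ/mem_lspan/mem_nth.
Qed.

Lemma N_act (n : N) : [/\ t *: n = 0, u *: n = 0, v *: n = x *: n, y *: n = x *: n
  & z *: n = x *: n].
Proof.
split; [exact: (@relN_act 0%N) | exact: (@relN_act 1%N) | | |].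
all: apply/subr0_eq; rewrite -scalerBl.
- exact: (@relN_act 2%N).
- exact: (@relN_act 3%N).
- exact: (@relN_act 4%N).
Qed.

(** As [lambda] is a derivation over [eps], it suffices that both maps vanish on the generators. *)
Lemma lambda_relN w : w \in lspan relN -> eps w = 0 /\ lambda w = 0.
Proof.
have gens e : e \in relN -> eps e = 0 /\ lambda e = 0.
  by rewrite !inE /eps /lambda; do ![case/orP=> [/eqP->|] | move/eqP=> ->];
    rewrite ?ring_coordB !ring_coord_gen /=; split; ring.
move=> /asboolP[c ->]; elim/big_ind: _ => [|w1 w2 [e1 l1] [e2 l2]|i _].
- by rewrite /eps /lambda rmorph0 /= !addr0.
- by rewrite epsD lambdaD e1 e2 l1 l2 addr0.
have [e0 l0] := gens _ (mem_nth 0 (ltn_ord i)).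
have -> : c i *: relN`_i = (c i : R) * relN`_i by [].
by rewrite epsM lambda_leibniz e0 l0 !mulr0 addr0.
Qed.

(** If x r is a relation, then eps r = lambda (x r) = 0, so r is a combination of the variables; on
    N these act as 0 or as x. *)
Lemma N_colon (n : N) : x *: n = 0 -> exists m, n = x *: m.
Proof.
have [r ->] := piN_surj n; rewrite -linearZ -[X in _ = X](linear0 piN).
move=> /lquot_piP; rewrite subr0 => /lambda_relN[_].
have -> : x *: r = x * (r : R) by [].
rewrite lambda_leibniz.
have -> : eps x = 0 by rewrite /eps ring_coord_gen.
have -> : lambda x = 1 by rewrite /lambda ring_coord_gen /= !add0r !addr0.
rewrite mul0r add0r mul1r => /eps_eq0_decomp[r1 [r2 [r3 [r4 [r5 [r6 rE]]]]]].
exists (piN (r3 + r4 + r5 + r6)).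
have piND (a b : R) : piN (a + b) = piN a + piN b by exact: (linearD piN).
have piNM (a b : R) : piN (a * b) = a *: piN b by rewrite -linearZ.
rewrite rE !piND !piNM.
have [-> _ _ _ _] := N_act (piN r1).
have [_ -> _ _ _] := N_act (piN r2).
have [_ _ -> _ _] := N_act (piN r3).
have [_ _ _ -> _] := N_act (piN r5).
have [_ _ _ _ ->] := N_act (piN r6).
by rewrite !add0r -!scalerDr.
Qed.

Lemma N_residual :
  exists chi : N -> k, residual eps chi /\ forall r, chi (piN r) = eps r.
Proof.
have [f fE] := choice piN_surj; exists (fun n => eps (f n)).
have chi_pi r : eps (f (piN r)) = eps r.
  apply/subr0_eq; rewrite -epsB.
  suff /lambda_relN[] : f (piN r) - r \in lspan relN by [].
  by apply/lquot_piP; apply: (esym (fE (piN r))).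
split=> // r w w'; rewrite (fE w) (fE w') -linearP !chi_pi.
rewrite -[X in eps X = _]/(GRing.add (r * (f w : R) : R) (f w' : R)).
by rewrite epsD epsM.
Qed.

(** * The module M, with the dual of R^2 identified with R^2 *)

Definition row_fun (w : R2) (c : 'cV[R]_2) : R^o := w.1 * c 0 0 + w.2 * c 1 0.

Lemma row_linear w : linear (row_fun w).
Proof.
move=> a c d; rewrite /row_fun !mxE.
by rewrite -[RHS]/(a * (w.1 * c 0 0 + w.2 * c 1 0) + (w.1 * d 0 0 + w.2 * d 1 0)); ring.
Qed.

Definition row_hom (w : R2) : Defs.hom 'cV[R]_2 R^o := linear_of (row_linear w).

Lemma row_hom_linear : linear row_hom.
Proof.
move=> a [w1 w2] [w1' w2']; apply: hom_ext => c.
rewrite -[LHS]/((a * w1 + w1') * c 0 0 + (a * w2 + w2') * c 1 0).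
rewrite -[RHS]/(a * (w1 * c 0 0 + w2 * c 1 0) + (w1' * c 0 0 + w2' * c 1 0)).
ring.
Qed.

Lemma row_hom_surj g : exists w, g = row_hom w.
Proof.
exists (g (delta_mx 0 0), g (delta_mx 1 0)); apply: hom_ext => c.
rewrite {1}(cV2E c) linearD !linearZ; congr (_ + _); exact: mulrC.
Qed.

Lemma row_hom_inj : injective row_hom.
Proof.
move=> [w1 w2] [w1' w2'] ww'.
have E c : row_fun (w1, w2) c = row_fun (w1', w2') c.
  exact: (congr1 (fun f : Defs.hom _ _ => f c) ww').
have := E (delta_mx 0 0); have := E (delta_mx 1 0).
by rewrite /row_fun /= !mxE /= !mulr0 !mulr1 !add0r !addr0 => -> ->.
Qed.

Lemma hom_pre_row_hom w : hom_pre R^o (d0 al) (row_hom w) = row_hom (dual_d al w).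
Proof.
apply: hom_ext => c; case: w => w1 w2.
have d0E i : d0 al c i 0 = d0_mx al i 0 * c 0 0 + d0_mx al i 1 * c 1 0.
  rewrite mxE big_ord_recl big_ord1; congr (_ * c _ _ + _ i _ * c _ _); exact: val_inj.
rewrite -[LHS]/(w1 * d0 al c 0 0 + w2 * d0 al c 1 0) !d0E !mxE /= clsZ.
rewrite -[RHS]/((v * w1 + ring_scalar al * x * w2) * c 0 0 + (y * w1 + z * w2) * c 1 0).
ring.
Qed.

Definition piM : {linear R2 -> M} :=
  (@lquot_pi R _ _ \o linear_of row_hom_linear : R2 -> M).

Lemma piM_surj : surjective piM.
Proof.
move=> m; have [w wE] := row_hom_surj (repr m).
by exists w; rewrite /piM /= -wE lquot_reprK.
Qed.

Lemma piM_kernel w : piM w = 0 <-> w \in Defs.limg (dual_d al).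
Proof.
rewrite -[X in _ = X](linear0 (@lquot_pi R _ (Defs.limg (hom_pre R^o (d0 al))))).
apply: iff_trans (lquot_piP _ _ _) _; rewrite subr0; split=> /asboolP.
  move=> [g gE]; have [w' g_w'] := row_hom_surj g; apply/asboolP; exists w'.
  by apply: row_hom_inj; rewrite -hom_pre_row_hom -g_w'; apply: gE.
by move=> [w' ->]; apply/asboolP; exists (row_hom w'); apply/esym/hom_pre_row_hom.
Qed.

Lemma M_socle r : al != 0 -> 1 - al != 0 -> eps r = 0 -> r *: piM (t, t - x) = 0.
Proof.
move=> al0 al1 r0; rewrite -linearZ; apply/piM_kernel/asboolP.
by have [w wE] := socle_preimage al0 al1 r0; exists w.
Qed.

Lemma M_socle_notin (m : M) : piM (t, t - x) <> u *: m.
Proof.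
have [[w1 w2] <-] := piM_surj m; rewrite -linearZ => /eqP.
rewrite -subr_eq0 -linearB => /eqP/piM_kernel/asboolP[w' wE].
have e : t - u * w1 = (dual_d al w').1 := congr1 fst wE.
have tyu : t * y * u = 0.
  apply: (can_inj (ring_coordK)).
  by rewrite !ring_coordM !ring_coord_gen rmorph0; apply: cubicP => /=; ring.
have := tty_dual_d w'; rewrite -e mulrBr [_ * (u * _)]mulrA tyu mul0r subr0 mulrAC => tty0.
by have := tty_neq0; rewrite tty0 eqxx.
Qed.

Lemma dual_d_acyclic (a : k) (f : {linear R2 -> N}) :
  1 - a != 0 -> 1 - a * al != 0 -> (forall w, f (dual_d (a * al) w) = 0) ->
  exists h : {linear R2 -> N}, forall w, f w = h (dual_d a w).
Proof.
move=> a1 b1 f0; pose n1 := f (1, 0); pose n2 := f (0, 1).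
have fE w : f w = w.1 *: n1 + w.2 *: n2 by exact: linear_pair.
have [_ _ v1 y1 z1] := N_act n1; have [_ _ v2 y2 z2] := N_act n2.
(* On N the differential with parameter b = a al gives x n1 + x n2 = 0 and b x n1 + x n2 = 0, a
   system of determinant 1 - b up to sign. *)
have eq1 : x *: n1 + x *: n2 = 0.
  by have := f0 (1, 0); rewrite fE /= !mulr1 !mulr0 !addr0 v1 y2.
have eq2 : ring_scalar (a * al) *: (x *: n1) + x *: n2 = 0.
  by have := f0 (0, 1); rewrite fE /= !mulr1 !mulr0 !add0r z2 -scalerA.
have kap_inv (c : k) (n : N) : c != 0 -> ring_scalar c^-1 *: (ring_scalar c *: n) = n.
  by move=> c0; rewrite scalerA -rmorphM mulVf // rmorph1 scale1r.
have kapB (c : k) (n : N) : ring_scalar (1 - c) *: n = n - ring_scalar c *: n.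
  by rewrite rmorphB rmorph1 scalerBl scale1r.
have xn1 : x *: n1 = 0.
  rewrite -[LHS](kap_inv _ _ b1) kapB.
  suff <- : x *: n1 = ring_scalar (a * al) *: (x *: n1) by rewrite subrr scaler0.
  by apply: (addIr (x *: n2)); rewrite eq1 eq2.
have xn2 : x *: n2 = 0 by move: eq1; rewrite xn1 add0r.
have [[m1 n1E] [m2 n2E]] := (N_colon xn1, N_colon xn2).
(* The solution of h1 + h2 = m1 and a h1 + h2 = m2, which is the condition for h to factor f. *)
pose h1 := ring_scalar (1 - a)^-1 *: (m1 - m2); pose h2 := m1 - h1.
have [h hE] := pair_lift h1 h2; exists h => w.
have h12 : h1 + h2 = m1 by rewrite addrC subrK.
have ah12 : ring_scalar a *: h1 + h2 = m2.
  have h1E : h1 - ring_scalar a *: h1 = m1 - m2.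
    by rewrite -kapB /h1 scalerA mulrC -scalerA kap_inv.
  by rewrite /h2 addrCA -opprB h1E opprB addrC subrK.
have [_ _ v3 y3 z3] := N_act h1; have [_ _ v4 y4 z4] := N_act h2.
have act (r r' : R) (n : N) : (r * r') *: n = r' *: (r *: n) by rewrite scalerA mulrC.
rewrite fE n1E n2E hE -h12 -ah12 /= !(scalerDl, act) v3 y4 z4.
by rewrite !scalerDr addrACA.
Qed.

Lemma dual_d_exact (a : k) w : al != 0 -> a != 0 -> 1 - a != 0 -> 1 - a * al != 0 ->
  dual_d a w = 0 <-> w \in Defs.limg (dual_d (a * al)).
Proof.
move=> al0 a0 a1 b1; split=> [w0|/asboolP[w' ->]]; last exact: dual_d_dual_d.
by apply/asboolP; apply: dual_d_kernel.
Qed.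

Lemma Ext_M_N_eq0 j (e : Ext j.+1 M N) : infinite_order al -> e = 0.
Proof.
move=> [al0 al_order].
have pow0 n : al ^+ n != 0 by rewrite expf_neq0.
have pow1 n : 1 - al ^+ n.+1 != 0 by rewrite subr_eq0 eq_sym al_order.
have pow1_mul n : 1 - al ^+ n.+1 * al != 0 by rewrite -exprSr pow1.
(* The exponent starts at 1 because [dual_d al] presents M; infinite order keeps each 1 - al^(n+1)
   nonzero. *)
apply: (@Ext_resolution_eq0 _ _ _ _ piM (fun n => dual_d (al ^+ n.+1))).
- exact: pair_projective.
- exact: piM_surj.
- by move=> w; rewrite expr1; apply: piM_kernel.
- by move=> n w; rewrite [_ ^+ n.+2]exprSr; apply: dual_d_exact.
- by move=> n f f0; apply: dual_d_acyclic => // w; rewrite -exprSr; apply: f0.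
Qed.

Lemma Ext_N_M_neq0 j : al != 0 -> 1 - al != 0 -> exists e : Ext j.+1 N M, e <> 0.
Proof.
move=> al0 al1; have [chi [chi_res chi_pi]] := N_residual.
have chi1 : chi (piN 1) = 1 by rewrite chi_pi rmorph1.
have [_ u1 _ _ _] := N_act (piN 1).
have theta_u : theta u = 1 by rewrite /theta ring_coord_gen.
apply: (Ext_neq0 scalarK thetaD theta_leibniz theta_u u_sqr0 j chi_res chi1 u1 _
  M_socle_notin).
by move=> r; apply: M_socle.
Qed.

End RingCoordinates.

Local Close Scope ring_scope.

Theorem corollary3p3 (k : fieldType) (alpha : k)
    (k_not_alg : ~ algebraic_over_finite_field k)
    (alpha_order : infinite_order alpha) :
  (forall i : nat, 0 < i ->
     forall e : Ext i (module_M alpha) (module_N alpha), e = 0%R) /\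
  (forall i : nat, 0 < i ->
     exists e : Ext i (module_N alpha) (module_M alpha), e <> 0%R).
Proof.
split=> [[//|j] _ e|[//|j] _]; first exact: Ext_M_N_eq0.
have [alpha0 alpha_pow] := alpha_order; apply: Ext_N_M_neq0 => //.
by rewrite GRing.subr_eq0 eq_sym -[alpha]GRing.expr1 alpha_pow.
Qed.
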